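(* For all $n\geq 4$, the abelian group $gr^2(P\Sigma_n)=\Gamma_2(P\Sigma_n)/\Gamma_3(P\Sigma_n)$ has rank $$\phi_2(P\Sigma_n)=(n-1)\,r_n(2)=\frac{n(n-1)^2}{2},$$ and the set $\{[\xi_{ij},\xi_{ji}] : 1\leq i<j\leq n\}\cup\{[\xi_{ij},\xi_{it}] : 1\leq i\leq n,\ i\neq j,t,\ 1\leq j<t\leq n\}$ is a basis of it, where $[a,b]$ denotes the class of the commutator $(a,b)$ modulo $\Gamma_3(P\Sigma_n)$.
   Context: $F_n$ is the free group on $x_1,\dots,x_n$. For $1\leq i\neq j\leq n$, $\xi_{ij}=\xi_{i,j}\in\mathrm{Aut}(F_n)$ is given by $\xi_{i,j}(x_i)=x_j^{-1}x_ix_j$, $\xi_{i,j}(x_l)=x_l$ for $l\neq i$; $P\Sigma_n$ is the subgroup of $\mathrm{Aut}(F_n)$ generated by all $\xi_{i,j}$. $\Gamma_k$ denotes the lower central series; $(a,b)=a^{-1}b^{-1}ab$. $r_n(2)=\frac{n^2-n}{2}$ is the rank of $\Gamma_2(F_n)/\Gamma_3(F_n)$. *)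

(* Defs.v *)
From mathcomp Require Import all_boot all_algebra.
Set Implicit Arguments. Unset Strict Implicit. Unset Printing Implicit Defensive.

(* a letter (m, true) is x_m, (m, false) is x_m^{-1} *)
Definition fword (n : nat) := seq ('I_n * bool).

Definition cons_red n (a : 'I_n * bool) (w : fword n) : fword n :=
  match w with
  | b :: w' => if (b.1 == a.1) && (b.2 != a.2) then w' else a :: w
  | [::] => [:: a]
  end.

Definition freduce n (w : fword n) : fword n := foldr (@cons_red n) [::] w.

Definition finv n (w : fword n) : fword n := rev [seq (a.1, ~~ a.2) | a <- w].

Definition fsubst n (f : 'I_n -> fword n) (w : fword n) : fword n :=
  freduce (flatten [seq if a.2 then f a.1 else finv (f a.1) | a <- w]).

(* (i, j, true) stands for xi_{i,j}, (i, j, false) for xi_{i,j}^{-1} *)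
Definition xletter (n : nat) := ('I_n * 'I_n * bool)%type.

Definition xi_img n (l : xletter n) (m : 'I_n) : fword n :=
  let: (i, j, e) := l in
  if m == i then
    (if e then [:: (j, false); (i, true); (j, true)]
          else [:: (j, true); (i, true); (j, false)])
  else [:: (m, true)].

Definition xi_act n (l : xletter n) (w : fword n) : fword n :=
  fsubst (xi_img l) w.

(* formal products of the xi^{+-1}; the word l_1 ... l_k denotes the
   automorphism l_1 o ... o l_k, determined by its values on generators *)
Definition pword (n : nat) := seq (xletter n).

Definition peval n (w : pword n) (m : 'I_n) : fword n :=
  foldr (@xi_act n) [:: (m, true)] w.

Definition peq n (u v : pword n) : Prop := forall m, peval u m = peval v m.

Definition pinv n (w : pword n) : pword n := rev [seq (l.1, ~~ l.2) | l <- w].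

Definition pcomm n (a b : pword n) : pword n := pinv a ++ pinv b ++ a ++ b.

Definition xi n (i j : 'I_n) : pword n := [:: (i, j, true)].

Inductive gen_sub n (S : pword n -> Prop) : pword n -> Prop :=
  | gs_gen w : S w -> gen_sub S w
  | gs_one : gen_sub S [::]
  | gs_mul u v : gen_sub S u -> gen_sub S v -> gen_sub S (u ++ v)
  | gs_inv u : gen_sub S u -> gen_sub S (pinv u)
  | gs_eq u v : gen_sub S u -> peq u v -> gen_sub S v.

Definition PSigma n : pword n -> Prop :=
  gen_sub (fun w => exists i j : 'I_n, i != j /\ w = xi i j).

(* lcs k = Gamma_{k+1}(P\Sigma_n);  Gamma_{k+1} = < (a,b) : a in Gamma_k, b in G > *)
Fixpoint lcs n (k : nat) : pword n -> Prop :=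
  match k with
  | 0 => @PSigma n
  | k'.+1 => gen_sub (fun w => exists a b, @lcs n k' a /\ PSigma b /\ w = pcomm a b)
  end.

Definition Gamma n (k : nat) : pword n -> Prop := @lcs n k.-1.

Definition ppow n (w : pword n) (z : int) : pword n :=
  match z with
  | Posz k => flatten (nseq k w)
  | Negz k => flatten (nseq k.+1 (pinv w))
  end.

Definition pprod_pow n (bs : seq (pword n)) (es : seq int) : pword n :=
  flatten [seq ppow p.1 p.2 | p <- zip bs es].

Definition basis1 n : seq (pword n) :=
  flatten [seq [seq pcomm (xi i j) (xi j i) | j : 'I_n <- enum 'I_n & (i < j)%N]
          | i : 'I_n <- enum 'I_n].

Definition basis2 n : seq (pword n) :=
  flatten [seq flatten [seq [seq pcomm (xi i j) (xi i t)
                              | t : 'I_n <- enum 'I_n & ((j < t)%N && (t != i))]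
                       | j : 'I_n <- enum 'I_n & j != i]
          | i : 'I_n <- enum 'I_n].

Definition psigma_basis n : seq (pword n) := basis1 n ++ basis2 n.

(* r_n(2) = rank of Gamma_2(F_n)/Gamma_3(F_n) *)
Definition rn2 (n : nat) : nat := (n ^ 2 - n) %/ 2.

(* Main.v *)
(* Words in the xi_ij^{+-1} modulo [peq] form a group.  In any group the
   commutator is bimultiplicative from Gamma_1 x Gamma_1 to Gamma_2 / Gamma_3,
   so spanning reduces to commutators of generators, where McCool's relations
   suffice: xi_ij and xi_kl commute when k is not i or j and l is not i, and
   xi_ij xi_kj commutes with xi_ik.

   For independence, let automorphisms act by precomposition on integer-valued
   functions on the free group, filtered by polynomial degree.  Each xi_ij acts
   as the identity up to terms of lower degree; by (a-1)(b-1) - (b-1)(a-1),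
   elements of Gamma_k lower the degree by k.  Thus for f of degree at
   most 3 and p in Gamma_3, f o p - f is constant, hence 0 as p fixes the empty
   word; and f(p(w)) - f(w) is additive in p on Gamma_2.  Taking for f the
   Magnus coefficient of X_i X_j X_t (resp. X_i X_j X_i) and w = x_i gives an
   additive function that is nonzero on [xi_ij, xi_it] (resp. [xi_ij, xi_ji])
   and vanishes on all the other basis elements. *)
From HB Require Import structures.
Require Import Defs.
From mathcomp Require Import all_boot all_algebra.
From mathcomp Require Import zify ring.

Set Implicit Arguments. Unset Strict Implicit. Unset Printing Implicit Defensive.

(** * Commutators of generators span the second lower central quotient *)

Section LowerCentralSpan.
Local Open Scope group_scope.
Variable G : groupType.

(** Counterpart of [gen_sub] in an abstract group, where equality of elements takes the place of
    closure under [peq]. *)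
Inductive sgen (S : G -> Prop) : G -> Prop :=
  | sgen_gen g of S g : sgen S g
  | sgen1 : sgen S 1
  | sgenM g h of sgen S g & sgen S h : sgen S (g * h)
  | sgenV g of sgen S g : sgen S g^-1.

Variable X : G -> Prop.

Fixpoint glcs (k : nat) : G -> Prop :=
  if k is k'.+1 then
    sgen (fun g => exists a b, glcs k' a /\ sgen X b /\ g = [~ a, b])
  else sgen X.
Arguments glcs : simpl never.

Lemma glcs1 k : glcs k 1. Proof. by case: k => *; apply: sgen1. Qed.

Lemma glcsM k g h : glcs k g -> glcs k h -> glcs k (g * h).
Proof. by case: k => *; apply: sgenM. Qed.

Lemma glcsV k g : glcs k g -> glcs k g^-1.
Proof. by case: k => *; apply: sgenV. Qed.

Lemma glcsR k a b : glcs k a -> sgen X b -> glcs k.+1 [~ a, b].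
Proof. by move=> *; apply: sgen_gen; exists a, b. Qed.

(** Conjugation distributes over commutators, so [[~ c, d] ^ b] is the commutator of the conjugates,
    and induction on [k] applies to [c ^ b]. *)
Lemma glcsJ k a b : glcs k a -> sgen X b -> glcs k (a ^ b).
Proof.
elim: k a b => [|k IHk] a b.
  by move=> Ha Hb; apply: sgenM; [apply: sgenV | apply: sgenM].
move=> + Hb; elim=> [_ [c [d [Hc [Hd ->]]]]||g h _ Hg _ Hh|g _ Hg].
- rewrite conjRg; apply: glcsR; first exact: IHk.
  by apply: sgenM; [apply: sgenV | apply: sgenM].
- by rewrite conj1g; apply: sgen1.
- by rewrite conjMg; apply: sgenM.
- by rewrite conjVg; apply: sgenV.
Qed.

Lemma glcs_pred k a : glcs k.+1 a -> glcs k a.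
Proof.
elim=> [_ [c [d [Hc [Hd ->]]]]||g h _ Hg _ Hh|g _ Hg].
- by rewrite commgEl; apply: glcsM; [apply: glcsV | apply: glcsJ].
- exact: glcs1.
- exact: glcsM.
- exact: glcsV.
Qed.

Lemma glcs_sgen k a : glcs k a -> sgen X a.
Proof. by elim: k => // k IHk /glcs_pred. Qed.

(** Congruence modulo Gamma_3, since [glcs k] is Gamma_{k+1}. *)
Definition eqm (g h : G) : Prop := glcs 2 (g^-1 * h).

Lemma eqm_refl g : eqm g g. Proof. by rewrite /eqm mulVg; apply: glcs1. Qed.

Lemma eqm_sym g h : eqm g h -> eqm h g.
Proof. by move/glcsV; rewrite invgM invgK. Qed.

Lemma eqm_trans g h i : eqm g h -> eqm h i -> eqm g i.
Proof. by move=> Hg /(glcsM Hg); rewrite mulgA mulgK. Qed.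

(** The left quotient of the products is [h^-1 * h'] times the conjugate of [g^-1 * g'] by [h'],
    whence the membership condition on [h']. *)
Lemma eqmM g g' h h' : sgen X h' -> eqm g g' -> eqm h h' ->
  eqm (g * h) (g' * h').
Proof.
move=> Hh' Hg Hh; rewrite /eqm.
have -> : (g * h)^-1 * (g' * h') = (h^-1 * h') * (g^-1 * g') ^ h'.
  by rewrite invgM conjgE !mulgA mulgK.
by apply: glcsM => //; apply: glcsJ.
Qed.

(** Conjugating the inverse of [g^-1 * h] by [g^-1] gives the right quotient, the form in which
    spanning is finally stated. *)
Lemma eqm_div g h : sgen X g -> eqm g h -> glcs 2 (g * h^-1).
Proof.
move=> Gg /glcsV/glcsJ/(_ (sgenV Gg)).
by rewrite invgM invgK conjgE invgK !mulgA mulgK.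
Qed.

(** Gamma_2 is central modulo Gamma_3: [(h * g)^-1 * (g * h)] is [[~ g, h]]. *)
Lemma eqmC g h : glcs 1 g -> sgen X h -> eqm (g * h) (h * g).
Proof.
move=> Hg Hh; apply: eqm_sym.
by rewrite /eqm invgM -!mulgA; apply: glcsR.
Qed.

(** * Integer powers and spanning modulo Gamma_3 *)

Definition zexpg (g : G) (z : int) : G :=
  match z with Posz k => g ^+ k | Negz k => g ^- k.+1 end.

Fixpoint zprod (bs : seq G) (es : seq int) : G :=
  if bs is b :: bs' then
    if es is e :: es' then zexpg b e * zprod bs' es' else 1
  else 1.

Lemma zexpg_oppn g (k : nat) : zexpg g (- k%:Z)%R = g ^- k.
Proof. by case: k => [|k] //=; rewrite expg0 invg1. Qed.

(** Writing integers as differences of naturals spares [zexpgD] a case analysis on signs. *)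
Lemma zexpgB g (k l : nat) : zexpg g (k%:Z - l%:Z)%R = g ^+ k * g ^- l.
Proof.
case: (leqP l k) => [le_lk|/ltnW le_kl].
  by rewrite -(subnK le_lk) expgnDr mulgK PoszD GRing.addrK.
rewrite -[in RHS](subnK le_kl) addnC expgnDr invgM.
have -> : (k%:Z - l%:Z = - (l - k)%N%:Z)%R by lia.
have C : commute (g ^+ k) (g ^- (l - k)) by apply: commuteV; apply: commuteX2.
by rewrite zexpg_oppn mulgA C mulgK.
Qed.

Lemma int_subn (z : int) : exists k l : nat, z = (k%:Z - l%:Z)%R.
Proof. by case: z => k; [exists k, 0 | exists 0, k.+1]; lia. Qed.

Lemma zexpgD g (y z : int) : zexpg g (y + z)%R = zexpg g y * zexpg g z.
Proof.
have [k [l ->]] := int_subn y; have [k' [l' ->]] := int_subn z.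
have -> : (k%:Z - l%:Z + (k'%:Z - l'%:Z) = (k + k')%N%:Z - (l + l')%N%:Z)%R by lia.
have C : commute (g ^- l) (g ^+ k' * g ^- l').
  by apply: commuteM; rewrite -!expVgn; apply: commuteX2;
    [apply: commute_sym; apply: commuteV | ].
by rewrite !zexpgB -[RHS]mulgA C !expgnDr invgM !mulgA.
Qed.

Variable B : seq G.
Hypothesis B_lcs : forall b, b \in B -> glcs 1 b.

Lemma zexpg_glcs k b z : glcs k b -> glcs k (zexpg b z).
Proof.
move=> Hb; have Hn m : glcs k (b ^+ m).
  by elim: m => [|m IHm]; [apply: glcs1 | rewrite expgS; apply: glcsM].
by case: z => m /=; last apply: glcsV; apply: Hn.
Qed.

Lemma zprod_glcs bs es : {subset bs <= B} -> glcs 1 (zprod bs es).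
Proof.
elim: bs es => [|b bs IHb] [|e es] sB /=; try exact: glcs1.
apply: glcsM; first by apply/zexpg_glcs/B_lcs/sB/mem_head.
by apply: IHb => c Hc; apply: sB; rewrite inE Hc orbT.
Qed.

(** Merging the two products moves [zexpg b e'] past [zprod bs es], which [eqmC] allows. *)
Lemma zprodD bs es es' : {subset bs <= B} ->
  size es = size bs -> size es' = size bs ->
  eqm (zprod bs [seq (p.1 + p.2)%R | p <- zip es es'])
      (zprod bs es * zprod bs es').
Proof.
elim: bs es es' => [|b bs IHb] [|e es] [|e' es'] //= sB; last first.
  move=> [Hes] [Hes']; have sB' : {subset bs <= B}.
    by move=> c Hc; apply: sB; rewrite inE Hc orbT.
  have Hb := B_lcs (sB _ (mem_head _ _)).
  have P := zprod_glcs _ sB'.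
  rewrite zexpgD; apply: (@eqm_trans _
    (zexpg b e * zexpg b e' * (zprod bs es * zprod bs es'))).
    apply: eqmM; last exact: IHb; last exact: eqm_refl.
    by apply: sgenM; apply: (glcs_sgen (k := 1)).
  rewrite -!mulgA; apply: eqmM; [|exact: eqm_refl|].
    by apply: (glcs_sgen (k := 1)); do !apply: glcsM => //; apply: zexpg_glcs.
  rewrite !mulgA; apply: eqmM; [exact: (glcs_sgen (k := 1))| |exact: eqm_refl].
  by apply: eqmC; [exact: zexpg_glcs | apply: (glcs_sgen (k := 1))].
by rewrite mulg1 => _ _; apply: eqm_refl.
Qed.

Definition spanned (g : G) : Prop :=
  exists es : seq int, size es = size B /\ eqm g (zprod B es).

Lemma zprod0 bs : zprod bs (nseq (size bs) 0%R) = 1.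
Proof. by elim: bs => //= b bs ->; rewrite expg0 mulg1. Qed.

Lemma spanned_glcs2 g : glcs 2 g -> spanned g.
Proof.
move=> Hg; exists (nseq (size B) 0%R); split; first exact: size_nseq.
by rewrite zprod0 /eqm mulg1; apply: glcsV.
Qed.

Lemma spannedM g h : spanned g -> spanned h -> spanned (g * h).
Proof.
move=> [es [Hes Hg]] [es' [Hes' Hh]].
exists [seq (p.1 + p.2)%R | p <- zip es es']; split.
  by rewrite size_map size_zip Hes Hes' minnn.
apply: (@eqm_trans _ (zprod B es * zprod B es')); last first.
  by apply: eqm_sym; apply: zprodD.
by apply: eqmM => //; apply: (glcs_sgen (k := 1)); apply: zprod_glcs.
Qed.

(** Negated exponents invert the product only modulo Gamma_3; this is additivity of the exponents
    applied to [es] and [- es]. *)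
Lemma spannedV g : spanned g -> spanned g^-1.
Proof.
move=> [es [Hes Hg]]; pose es' := [seq (- e)%R | e <- es].
have Hes' : size es' = size B by rewrite size_map.
have P e : glcs 1 (zprod B e) by apply: zprod_glcs.
exists es'; split=> //.
have H1 : eqm 1 (zprod B es * zprod B es').
  rewrite -[X in eqm X](zprod0 B) -Hes.
  have -> : nseq (size es) 0%R = [seq (p.1 + p.2)%R | p <- zip es es'].
    rewrite /es'; elim: (es) => //= e s ->; congr (_ :: _); lia.
  exact: zprodD.
have {1}-> : g^-1 = g^-1 * 1 by rewrite mulg1.
have -> : zprod B es' = (zprod B es)^-1 * (zprod B es * zprod B es').
  by rewrite mulKg.
apply: eqmM => //; first by apply: sgenM; apply: (glcs_sgen (k := 1)).
(* Membership of [g] in the group is recovered from its congruence to a product of elements of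
   [B]. *)
have Gg : sgen X g.
  have -> : g = zprod B es * (g^-1 * zprod B es)^-1 by rewrite invgM invgK mulVKg.
  by apply: sgenM; [apply: (glcs_sgen (k := 1)) | apply: sgenV; apply: (glcs_sgen Hg)].
by rewrite /eqm invgK; apply: eqm_div.
Qed.

Lemma spanned_mem b : b \in B -> spanned b.
Proof.
rewrite /spanned; elim: B => //= c s IHs; rewrite inE => /orP[/eqP ->|/IHs].
  exists (1%R :: nseq (size s) 0%R); rewrite /= size_nseq; split=> //.
  by rewrite zprod0 expg1 mulg1; apply: eqm_refl.
move=> [es [Hes Hb]]; exists (0%R :: es); rewrite /= Hes; split=> //.
by rewrite expg0 mul1g.
Qed.

Lemma spannedJ g v : glcs 1 g -> sgen X v -> spanned g -> spanned (g ^ v).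
Proof.
move=> Hg Hv Sg; have -> : g ^ v = g * [~ g, v] by rewrite commgEl mulVKg.
by apply: spannedM => //; apply/spanned_glcs2/glcsR.
Qed.

(** The map sending [a] to [[~ a, b]] is multiplicative up to conjugation, and conjugation is
    trivial on Gamma_2 modulo Gamma_3. *)
Lemma spanned_comm_l b : sgen X b -> (forall x, X x -> spanned [~ x, b]) ->
  forall a, sgen X a -> spanned [~ a, b].
Proof.
move=> Hb HX a; elim=> [x /HX //||g h Gg Hg Gh Hh|g Gg Hg].
- by rewrite comm1g; apply/spanned_glcs2/glcs1.
- have -> : [~ g * h, b] = [~ g, b] ^ h * [~ h, b].
    by rewrite !commgEl !conjgE !invgM !mulgA !mulgK.
  by apply: spannedM => //; apply: spannedJ => //; apply: glcsR.
- have -> : [~ g^-1, b] = ([~ g, b]^-1) ^ g^-1.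
    by rewrite invgR !commgEl !conjgE !invgK !mulgA mulgK.
  apply: spannedJ; [apply: glcsV; exact: glcsR | exact: sgenV | exact: spannedV].
Qed.

(** The previous lemma is used in each argument, the two being exchanged by inverting the
    commutator. *)
Lemma glcs1_spanned : (forall x y, X x -> X y -> spanned [~ x, y]) ->
  forall g, glcs 1 g -> spanned g.
Proof.
move=> HX g; elim=> [_ [a [b [Ha [Hb ->]]]]||h k _ Hh _ Hk|h _ Hh].
- apply: spanned_comm_l => // x Xx; rewrite -invgR; apply: spannedV.
  by apply: spanned_comm_l (sgen_gen Xx) _ _ Hb => y Xy; apply: HX.
- exact/spanned_glcs2/glcs1.
- exact: spannedM.
- exact: spannedV.
Qed.

End LowerCentralSpan.

(** * Free reduction and the action of words *)

Section FreeReduction.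
Variable n : nat.
Implicit Types (a b : 'I_n * bool) (u v w : fword n).

Definition linv a : 'I_n * bool := (a.1, ~~ a.2).

Lemma linvK : involutive linv.
Proof. by case=> m e; rewrite /linv /= negbK. Qed.

Lemma cons_redE a b w :
  cons_red a (b :: w) = if b == linv a then w else a :: b :: w.
Proof.
case: a b => m e [m' e'].
by rewrite /linv xpair_eqE /=; case: e e' => [] [].
Qed.

Definition reduced w : bool := sorted (fun a b => b != linv a) w.

Lemma reduced_cons_red a w : reduced w -> reduced (cons_red a w).
Proof.
case: w => [//|b w] Hw; rewrite cons_redE; case: ifP => [_|Hb].
  exact: path_sorted Hw.
by rewrite /= Hb.
Qed.

(** Van der Waerden's argument: letters act on reduced words by permutations, inverse letters by
    inverse permutations. *)
Lemma cons_redK a w : reduced w -> cons_red (linv a) (cons_red a w) = w.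
Proof.
case: w => [_|b w]; first by rewrite [cons_red a _]/= cons_redE linvK eqxx.
rewrite cons_redE; case: (b =P linv a) => [-> Hw|Hb Hw]; last first.
  by rewrite cons_redE linvK eqxx.
by case: w Hw => [//|c w] /andP[Hc _]; rewrite cons_redE (negPf Hc).
Qed.

Lemma freduce_reduced w : reduced (freduce w).
Proof. by elim: w => //= a w; apply: reduced_cons_red. Qed.

Definition weq u v : Prop := freduce u = freduce v.

Lemma freduce_cat u v : freduce (u ++ v) = foldr (@cons_red n) (freduce v) u.
Proof. exact: foldr_cat. Qed.

Lemma foldr_cons_red a v w : reduced v ->
  foldr (@cons_red n) v (cons_red a w) = cons_red a (foldr (@cons_red n) v w).
Proof.
move=> Hv; case: w => [//|b w].
rewrite cons_redE; case: eqP => [-> /= | _ //].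
rewrite -[X in cons_red X (cons_red _ _)]linvK cons_redK //.
by elim: w => //= c w; apply: reduced_cons_red.
Qed.

Lemma foldr_freduce u v : reduced v ->
  foldr (@cons_red n) v (freduce u) = foldr (@cons_red n) v u.
Proof. by move=> Hv; elim: u => //= a u <-; rewrite foldr_cons_red. Qed.

(** By [foldr_freduce], a word acts on reduced words through its reduction, so concatenation passes
    to the free group. *)
Lemma weq_cat u u' v v' : weq u u' -> weq v v' -> weq (u ++ v) (u' ++ v').
Proof.
rewrite /weq => Hu Hv; rewrite !freduce_cat -(foldr_freduce u) ?freduce_reduced //.
by rewrite Hu Hv foldr_freduce // freduce_reduced.
Qed.

Lemma weq_linv a : weq [:: linv a; a] [::].
Proof. by rewrite /weq [LHS]cons_redE linvK eqxx. Qed.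

Lemma finv_cat u v : @Defs.finv n (u ++ v) = Defs.finv v ++ Defs.finv u.
Proof. by rewrite /Defs.finv map_cat rev_cat. Qed.

Lemma finvK : involutive (@Defs.finv n).
Proof.
move=> w; rewrite /Defs.finv map_rev revK -map_comp -[RHS]map_id.
by apply: eq_map => -[m e] /=; rewrite negbK.
Qed.

Lemma finv_cons a w : @Defs.finv n (a :: w) = Defs.finv w ++ [:: linv a].
Proof. by rewrite -cat1s finv_cat. Qed.

Lemma weq_finvl w : weq (Defs.finv w ++ w) [::].
Proof.
elim: w => // a w IHw; rewrite finv_cons -catA cat1s.
apply: etrans IHw; apply: weq_cat => //.
by rewrite -(cat1s a w) -cat1s catA; apply: (@weq_cat _ [::] w w) => //; apply: weq_linv.
Qed.

Lemma weq_finvr w : weq (w ++ Defs.finv w) [::].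
Proof. by rewrite -{1}(finvK w); apply: weq_finvl. Qed.

Lemma weq_finv u v : weq u v -> weq (Defs.finv u) (Defs.finv v).
Proof.
move=> Huv; apply: (@etrans _ _ (freduce (Defs.finv u ++ u ++ Defs.finv v))).
  rewrite -[in LHS](cats0 (Defs.finv u)); apply: weq_cat => //; apply: esym.
  by apply: etrans (weq_finvr v); apply: weq_cat.
by rewrite catA; apply: (@weq_cat _ [::] _ _ (weq_finvl u)).
Qed.

(** [fsubst] without the final reduction, which makes it strictly multiplicative on words. *)
Definition wsubst (f : 'I_n -> fword n) w : fword n :=
  flatten [seq if a.2 then f a.1 else Defs.finv (f a.1) | a <- w].

Lemma wsubst_cat f u v : wsubst f (u ++ v) = wsubst f u ++ wsubst f v.
Proof. by rewrite /wsubst map_cat flatten_cat. Qed.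

Lemma wsubst_cons f a w : wsubst f (a :: w) = wsubst f [:: a] ++ wsubst f w.
Proof. by rewrite -cat1s wsubst_cat. Qed.

Lemma wsubst_linv f a : wsubst f [:: linv a] = Defs.finv (wsubst f [:: a]).
Proof. by case: a => m [] /=; rewrite /wsubst /= !cats0 ?finvK. Qed.

Lemma wsubst_finv f w : wsubst f (Defs.finv w) = Defs.finv (wsubst f w).
Proof.
elim: w => // a w IHw.
by rewrite finv_cons wsubst_cat IHw wsubst_linv -finv_cat -wsubst_cons.
Qed.

Lemma wsubst_freduce f w : weq (wsubst f (freduce w)) (wsubst f w).
Proof.
elim: w => //= a w IHw.
rewrite [in X in weq _ X]wsubst_cons; apply: (@etrans _ _ _ _ _ (weq_cat (erefl _) IHw)).
rewrite -wsubst_cons; case: (freduce w) => // b v; rewrite cons_redE.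
case: eqP => // ->; rewrite wsubst_cons (wsubst_cons f _ v) catA wsubst_linv.
by apply: esym; apply: (@weq_cat _ [::] _ _ (weq_finvr _)).
Qed.

Lemma wsubst_weq f u v : weq u v -> weq (wsubst f u) (wsubst f v).
Proof. by move=> Huv; rewrite /weq -wsubst_freduce Huv wsubst_freduce. Qed.

End FreeReduction.

(** * Action of products of the xi_ij on words *)

Section Action.
Variable n : nat.
Implicit Types (u v w : fword n) (p q : pword n) (l : xletter n).

Definition wact l w : fword n := wsubst (xi_img l) w.

Definition papp p w : fword n := foldr wact w p.

Lemma papp_cat p q w : papp (p ++ q) w = papp p (papp q w).
Proof. exact: foldr_cat. Qed.

Lemma papp_catw p u v : papp p (u ++ v) = papp p u ++ papp p v.
Proof. by elim: p => //= l p ->; apply: wsubst_cat. Qed.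

Lemma papp_nil p : papp p [::] = [::].
Proof. by elim: p => //= l p ->. Qed.

Lemma papp_finv p w : papp p (Defs.finv w) = Defs.finv (papp p w).
Proof. by elim: p => //= l p ->; apply: wsubst_finv. Qed.

Lemma papp_weq p u v : weq u v -> weq (papp p u) (papp p v).
Proof. by elim: p => //= l p IHp Huv; apply/wsubst_weq/IHp. Qed.

Lemma pevalE p m : peval p m = freduce (papp p [:: (m, true)]).
Proof. by elim: p => //= l p ->; apply: wsubst_freduce. Qed.

(** Endomorphisms of a free group agree as soon as they agree on the generators. *)
Lemma peqP p q : peq p q <-> forall w, weq (papp p w) (papp q w).
Proof.
split=> [Hpq w|Hpq m]; last by rewrite !pevalE; apply: Hpq.
have Hm m : weq (papp p [:: (m, true)]) (papp q [:: (m, true)]).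
  by rewrite /weq -!pevalE.
elim: w => [|[m e] w IHw]; first by rewrite !papp_nil.
rewrite -cat1s !papp_catw; apply: weq_cat => //; case: e => //.
by have := weq_finv (Hm m); rewrite -!papp_finv.
Qed.

Lemma peq_refl p : peq p p. Proof. by []. Qed.

Lemma peq_sym p q : peq p q -> peq q p.
Proof. by move=> H m. Qed.

Lemma peq_trans p q r : peq p q -> peq q r -> peq p r.
Proof. by move=> H H' m; rewrite H. Qed.

Lemma peq_cat p p' q q' : peq p p' -> peq q q' -> peq (p ++ q) (p' ++ q').
Proof.
move=> /peqP Hp /peqP Hq; apply/peqP => w; rewrite !papp_cat.
by apply: etrans (Hp _); apply: papp_weq.
Qed.

Definition xinv l : xletter n := (l.1, ~~ l.2).

Lemma peq_xinvl l : peq [:: xinv l; l] [::].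
Proof.
move=> m; case: l => [[i j] e].
rewrite /peval /= /xi_act /fsubst /xi_img /=.
have [->|mi] := eqVneq m i; last by rewrite /= (negPf mi).
(* Letters with equal indices are also words; they act as the identity. *)
have [->|ji] := eqVneq j i; first by case: e; do !rewrite /= ?eqxx.
have ij : (i == j) = false by rewrite eq_sym (negPf ji).
by case: e; do !rewrite /= ?eqxx ?ij ?(negPf ji).
Qed.

Lemma pinv_cons l p : @pinv n (l :: p) = pinv p ++ [:: xinv l].
Proof. by rewrite /pinv /= rev_cons -cats1. Qed.

Lemma pinvK : involutive (@pinv n).
Proof.
move=> w; rewrite /pinv map_rev revK -map_comp -[RHS]map_id.
by apply: eq_map => -[m e] /=; rewrite negbK.
Qed.

Lemma peq_pinvl p : peq (pinv p ++ p) [::].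
Proof.
elim: p => [|l p IHp]; first exact: peq_refl.
rewrite pinv_cons -catA cat1s; apply: peq_trans IHp.
apply: peq_cat; first exact: peq_refl.
rewrite -[p in X in peq X _]cat0s -(cat1s l) -cat1s !catA.
by apply: (@peq_cat _ [::] _ _ (peq_xinvl l)).
Qed.

Lemma peq_pinvr p : peq (p ++ pinv p) [::].
Proof. by rewrite -{1}(pinvK p); apply: peq_pinvl. Qed.

Lemma peq_pinv p q : peq p q -> peq (pinv p) (pinv q).
Proof.
move=> Hpq; apply: (@peq_trans _ (pinv p ++ p ++ pinv q)).
  rewrite -[X in peq X _]cats0; apply: peq_cat => //; apply: peq_sym.
  by apply: peq_trans (peq_pinvr q); apply: peq_cat.
by rewrite catA; apply: (@peq_cat _ [::] _ _ (peq_pinvl p)).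
Qed.

End Action.

(** * McCool's relations *)

Section AutomorphismGroup.
Variable n : nat.
Local Open Scope quotient_scope.
Implicit Types p q : pword n.

(** [peq] compares finitely many reduced words, so it is decidable and a quotient type can be
    formed. *)
Definition peqb p q : bool := [forall m, peval p m == peval q m].

Lemma peqbP p q : reflect (peq p q) (peqb p q).
Proof. exact: 'forall_eqP. Qed.

Lemma peqb_refl : reflexive peqb. Proof. by move=> p; apply/peqbP. Qed.

Lemma peqb_sym : symmetric peqb.
Proof. by move=> p q; apply/peqbP/peqbP; apply: peq_sym. Qed.

Lemma peqb_trans : transitive peqb.
Proof. by move=> q p r /peqbP Hpq /peqbP Hqr; apply/peqbP/(peq_trans Hpq). Qed.

Canonical peq_equiv := EquivRel peqb peqb_refl peqb_sym peqb_trans.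

Definition paut := {eq_quot peq_equiv}.
HB.instance Definition _ := Choice.on paut.

Definition pclass p : paut := \pi_({eq_quot peq_equiv}) p.
Definition prepr (g : paut) : pword n := repr (g : {eq_quot peq_equiv}).

Lemma preprK g : pclass (prepr g) = g. Proof. exact: reprK. Qed.

Lemma pclassP p q : pclass p = pclass q <-> peq p q.
Proof. by split=> [/eqmodP/peqbP | Hpq]; last exact/eqmodP/peqbP. Qed.

Lemma peq_prepr p : peq (prepr (pclass p)) p.
Proof. by apply/pclassP; rewrite preprK. Qed.

Definition paut_one := pclass [::].
Definition paut_inv g := pclass (pinv (prepr g)).
Definition paut_mul g h := pclass (prepr g ++ prepr h).

Lemma pclass_cat p q : pclass (p ++ q) = paut_mul (pclass p) (pclass q).
Proof. by apply/pclassP; apply: peq_cat; apply/peq_sym/peq_prepr. Qed.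

Lemma pclass_pinv p : pclass (pinv p) = paut_inv (pclass p).
Proof. by apply/pclassP/peq_pinv/peq_sym/peq_prepr. Qed.

Lemma paut_mulA : associative paut_mul.
Proof.
move=> g h k; rewrite -(preprK g) -(preprK h) -(preprK k) -!pclass_cat.
by rewrite catA.
Qed.

Lemma paut_mul1g : left_id paut_one paut_mul.
Proof. by move=> g; rewrite -(preprK g) -pclass_cat. Qed.

Lemma paut_mulg1 : right_id paut_one paut_mul.
Proof. by move=> g; rewrite -(preprK g) -pclass_cat cats0. Qed.

Lemma paut_mulVg : left_inverse paut_one paut_inv paut_mul.
Proof.
move=> g; rewrite -(preprK g) -pclass_pinv -pclass_cat.
exact/pclassP/peq_pinvl.
Qed.

Lemma paut_mulgV : right_inverse paut_one paut_inv paut_mul.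
Proof.
move=> g; rewrite -(preprK g) -pclass_pinv -pclass_cat.
exact/pclassP/peq_pinvr.
Qed.

HB.instance Definition _ := isGroup.Build paut
  paut_mulA paut_mul1g paut_mulg1 paut_mulVg paut_mulgV.

Local Open Scope group_scope.

Lemma pclassM p q : pclass (p ++ q) = pclass p * pclass q.
Proof. exact: pclass_cat. Qed.

Lemma pclassV p : pclass (pinv p) = (pclass p)^-1.
Proof. exact: pclass_pinv. Qed.

Lemma pclassR p q : pclass (pcomm p q) = [~ pclass p, pclass q].
Proof. by rewrite /pcomm !pclassM !pclassV. Qed.

Lemma pclassX p k : pclass (flatten (nseq k p)) = pclass p ^+ k.
Proof. by elim: k => //= k IHk; rewrite pclassM IHk expgS. Qed.

Lemma pclass_ppow p z : pclass (ppow p z) = zexpg (pclass p) z.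
Proof.
by case: z => k; rewrite /ppow pclassX //= pclassV expVgn.
Qed.

Lemma pclass_pprod_pow bs es :
  pclass (pprod_pow bs es) = zprod [seq pclass b | b <- bs] es.
Proof.
elim: bs es => [|b bs IHb] [|e es] //=.
by rewrite /pprod_pow /= pclassM pclass_ppow -IHb.
Qed.

Definition xiset (g : paut) : Prop :=
  exists i j : 'I_n, i != j /\ g = pclass (xi i j).

(** Because of [gs_eq], a generated set of words is a union of [peq] classes, hence the preimage of
    a subgroup of the quotient. *)
Lemma gen_subE (S : pword n -> Prop) (T : paut -> Prop) :
  (forall w, S w -> T (pclass w)) ->
  (forall g, T g -> exists w, S w /\ g = pclass w) ->
  forall w, gen_sub S w <-> sgen T (pclass w).
Proof.
move=> ST TS w; split.
  elim=> [v /ST Tv||u v _ Hu _ Hv|u _ Hu|u v _ Hu /pclassP <- //].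
  - exact: sgen_gen.
  - exact: sgen1.
  - by rewrite pclassM; apply: sgenM.
  - by rewrite pclassV; apply: sgenV.
move eg: (pclass w) => g Hg; elim: Hg w eg => {g}
    [g /TS[v [Sv ->]]||g h _ IHg _ IHh|g _ IHg] w.
- by move/esym/pclassP; apply: gs_eq; apply: gs_gen.
- by move/esym/pclassP; apply: gs_eq; apply: gs_one.
- rewrite -(preprK g) -(preprK h) -pclassM => /esym/pclassP; apply: gs_eq.
  by apply: gs_mul; [apply: IHg | apply: IHh]; apply: preprK.
- rewrite -(preprK g) -pclassV => /esym/pclassP; apply: gs_eq.
  by apply: gs_inv; apply: IHg; apply: preprK.
Qed.

Lemma PSigmaE w : PSigma w <-> sgen xiset (pclass w).
Proof.
apply: gen_subE => [v [i [j [ij ->]]]|g [i [j [ij ->]]]]; first by exists i, j.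
by exists (xi i j); split=> //; exists i, j.
Qed.

Lemma lcsE k w : lcs k w <-> glcs xiset k (pclass w).
Proof.
elim: k w => [|k IHk] w; first exact: PSigmaE.
apply: gen_subE => [v [a [b [Ha [Hb ->]]]]|g [a [b [Ha [Hb ->]]]]].
  exists (pclass a), (pclass b); rewrite pclassR.
  by split; [apply/IHk | split; [apply/PSigmaE |]].
exists (pcomm (prepr a) (prepr b)); rewrite pclassR !preprK; split=> //.
exists (prepr a), (prepr b); split; first by apply/IHk; rewrite preprK.
by split=> //; apply/PSigmaE; rewrite preprK.
Qed.

End AutomorphismGroup.

(** * Relations between generators and spanning of Gamma_2 modulo Gamma_3 *)

Section McCool.
Variable n : nat.
Local Open Scope group_scope.
Implicit Types i j k l : 'I_n.

Definition xig i j : paut n := pclass (xi i j).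

Lemma pclass_commute p q : peq (p ++ q) (q ++ p) ->
  [~ pclass p, pclass q : paut n] = 1.
Proof.
move=> Hpq; apply/eqP/commgP; rewrite /commute -!pclassM.
exact/pclassP.
Qed.

Lemma neq_false i j : i != j -> (i == j = false) * (j == i = false).
Proof. by move=> ij; split; last rewrite eq_sym; apply: negPf. Qed.

Lemma xig_disjoint i j k l : i != j -> k != l -> i != k -> j != k -> i != l ->
  [~ xig i j, xig k l] = 1.
Proof.
move=> /neq_false ij /neq_false kl /neq_false ik /neq_false jk /neq_false il.
apply: pclass_commute => m; rewrite /peval /= /xi_act /fsubst /xi_img /=.
have [->|/neq_false mi] := eqVneq m i.
  by do !rewrite /= ?(eqxx, ij, kl, ik, jk, il).
have [->|/neq_false mk] := eqVneq m k.
  by do !rewrite /= ?(eqxx, ij, kl, ik, jk, il).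
by rewrite /= mi mk.
Qed.

Lemma xig_same i j k : i != k -> i != j -> k != j -> [~ xig i j, xig k j] = 1.
Proof.
move=> ik ij kj; apply: xig_disjoint => //; by rewrite eq_sym.
Qed.

(** The product conjugates both x_i and x_k by x_j, and xi_ik fixes x_j. *)
Lemma xig_mccool i j k : i != j -> i != k -> j != k ->
  [~ xig i j * xig k j, xig i k] = 1.
Proof.
move=> /neq_false ij /neq_false ik /neq_false jk.
rewrite -pclassM; apply: pclass_commute => m.
rewrite /peval /= /xi_act /fsubst /xi_img /=.
have [->|/neq_false mi] := eqVneq m i.
  by do !rewrite /= ?(eqxx, ij, ik, jk).
have [->|/neq_false mk] := eqVneq m k.
  by do !rewrite /= ?(eqxx, ij, ik, jk).
by do !rewrite /= ?(mi, mk).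
Qed.

Variable B : seq (paut n).
Hypothesis B_lcs : forall b, b \in B -> glcs (@xiset n) 1 b.
Hypothesis B_ijji : forall i j, (i < j)%N -> [~ xig i j, xig j i] \in B.
Hypothesis B_ijit : forall i j t, j != i -> t != i -> (j < t)%N ->
  [~ xig i j, xig i t] \in B.
Local Notation spanned := (spanned (@xiset n) B).

Lemma xiset_xig i j : i != j -> sgen (@xiset n) (xig i j).
Proof. by move=> ij; apply: sgen_gen; exists i, j. Qed.

Lemma spanned_ijit i j t : j != i -> t != i -> spanned [~ xig i j, xig i t].
Proof.
move=> ji ti; case: (ltngtP j t) => [jt|tj|/val_inj ->].
- by apply: spanned_mem; apply: B_ijit.
- by rewrite -invgR; apply: spannedV => //; apply: spanned_mem; apply: B_ijit.
- by rewrite commgg; apply: spanned_glcs2; apply: glcs1.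
Qed.

Lemma spanned_ijji i j : i != j -> spanned [~ xig i j, xig j i].
Proof.
rewrite neq_ltn => /orP[ij|ji]; first by apply: spanned_mem; apply: B_ijji.
by rewrite -invgR; apply: spannedV => //; apply: spanned_mem; apply: B_ijji.
Qed.

(* By McCool's relation, [xi_kj, xi_ik] is conjugate to [xi_ij, xi_ik]^-1. *)
Lemma spanned_kjik i j k : i != j -> i != k -> j != k ->
  spanned [~ xig k j, xig i k].
Proof.
move=> ij ik jk.
have -> : [~ xig k j, xig i k] = ([~ xig i j, xig i k]^-1) ^ xig k j.
  apply/(mulgI ([~ xig i j, xig i k] ^ xig k j)).
  rewrite -conjMg mulgV conj1g -(xig_mccool ij ik jk).
  by rewrite !commgEl !conjgE !invgM !mulgA !mulgK.
have Hg : glcs (@xiset n) 1 [~ xig i j, xig i k] by apply: glcsR; apply: xiset_xig.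
apply: spannedJ => //; [exact: glcsV | by apply: xiset_xig; rewrite eq_sym |].
by apply: spannedV => //; apply: spanned_ijit; rewrite eq_sym.
Qed.

(** Coincidences among the indices decide: [i = k] gives a listed commutator up to inversion,
    [j = k] and [i = l] together the other listed kind, and just one of these two the conjugate
    handled by [spanned_kjik]; in the remaining cases the generators commute. *)
Lemma spanned_xig i j k l : i != j -> k != l -> spanned [~ xig i j, xig k l].
Proof.
have triv g : g = 1 -> spanned g by move=> ->; apply: spanned_glcs2; apply: glcs1.
move=> ij; case: (eqVneq i k) => [<- il|ik kl].
  by apply: spanned_ijit; rewrite eq_sym.
have [jl|jl] := eqVneq j l.
  by apply: triv; rewrite -jl; apply: xig_same; rewrite // jl.
case: (eqVneq j k) kl ik => [<-|jk] kl ik.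
  have [<-|il] := eqVneq i l; first exact: spanned_ijji.
  rewrite -invgR; apply: spannedV => //.
  by apply: spanned_kjik; rewrite // eq_sym.
case: (eqVneq i l) kl jl => [<-|il] kl jl.
  by apply: spanned_kjik; rewrite // eq_sym.
by apply: triv; apply: xig_disjoint.
Qed.

Lemma glcs1_xi_spanned g : glcs (@xiset n) 1 g -> spanned g.
Proof.
apply: glcs1_spanned => // _ _ [i [j [ij ->]]] [k [l [kl ->]]].
exact: spanned_xig.
Qed.

End McCool.

(** * Polynomial functions on the free group *)

Section PolynomialFunctions.
Variable n : nat.
Local Open Scope ring_scope.
Import GRing.Theory.
Implicit Types (f g : fword n -> int) (u v w : fword n) (p q : pword n).

Definition weq_invariant f : Prop := forall u v, weq u v -> f u = f v.

(** Degree by finite differences: every product of [k] operators u - 1, with u acting by left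
    translation, kills [f]. Thus [k = 0] means zero and [k = 1] constant. *)
Fixpoint deg_lt (k : nat) f : Prop :=
  if k is k'.+1 then forall u, deg_lt k' (fun w => f (u ++ w) - f w)
  else forall w, f w = 0.

Lemma deg_lt_ext k f g : f =1 g -> deg_lt k f -> deg_lt k g.
Proof.
elim: k f g => [|k IHk] f g fg Hf; first by move=> w; rewrite -fg.
by move=> u; apply: IHk (Hf u) => w; rewrite !fg.
Qed.

Lemma deg_lt0 k : deg_lt k (fun=> 0).
Proof. by elim: k => //= k IHk u; apply: deg_lt_ext IHk => w; rewrite subr0. Qed.

Lemma deg_ltS k f : deg_lt k f -> deg_lt k.+1 f.
Proof.
elim: k f => [|k IHk] f Hf u; first by move=> w; rewrite !Hf subr0.
exact: (IHk _ (Hf u)).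
Qed.

Lemma deg_ltD k f g : deg_lt k f -> deg_lt k g ->
  deg_lt k (fun w => f w + g w).
Proof.
elim: k f g => [|k IHk] f g Hf Hg; first by move=> w; rewrite Hf Hg addr0.
by move=> u; apply: deg_lt_ext (IHk _ _ (Hf u) (Hg u)) => w /=; ring.
Qed.

Lemma deg_ltZ k (c : int) f : deg_lt k f -> deg_lt k (fun w => c * f w).
Proof.
elim: k f => [|k IHk] f Hf; first by move=> w; rewrite Hf mulr0.
by move=> u; apply: deg_lt_ext (IHk _ (Hf u)) => w /=; ring.
Qed.

Lemma deg_ltB k f g : deg_lt k f -> deg_lt k g ->
  deg_lt k (fun w => f w - g w).
Proof.
move=> Hf /(deg_ltZ (-1)) Hg.
by apply: deg_lt_ext (deg_ltD Hf Hg) => w /=; ring.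
Qed.

Lemma deg_lt_catl k v f : deg_lt k f -> deg_lt k (fun w => f (v ++ w)).
Proof.
case: k => [|k] Hf; first by move=> w.
apply: deg_lt_ext (deg_ltD (deg_ltS (Hf v)) Hf) => w /=; ring.
Qed.

(** As [p] is multiplicative, the difference along [u] becomes the difference of [f] along
    [papp p u]. *)
Lemma deg_lt_papp k p f : deg_lt k f -> deg_lt k (fun w => f (papp p w)).
Proof.
elim: k f => [|k IHk] f Hf; first by move=> w.
by move=> u; apply: deg_lt_ext (IHk _ (Hf (papp p u))) => w; rewrite papp_catw.
Qed.

Lemma deg_lt1_const f w : deg_lt 1 f -> f w = f [::].
Proof. by move=> /(_ w [::]); rewrite cats0 => /subr0_eq. Qed.

(** This function is ((u-1)(v-1) - (v-1)(u-1)) applied to [f], up to the order convention for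
    translations. *)
Lemma deg_lt_swap k u v f : deg_lt k.+2 f ->
  deg_lt k (fun w => f (u ++ v ++ w) - f (v ++ u ++ w)).
Proof.
by move=> Hf; apply: deg_lt_ext (deg_ltB (Hf u v) (Hf v u)) => w /=; ring.
Qed.

Lemma weq_invariant_catl v f :
  weq_invariant f -> weq_invariant (fun w => f (v ++ w)).
Proof. by move=> Hf u w uw; apply/Hf/weq_cat. Qed.

Lemma weq_invariant_papp p f :
  weq_invariant f -> weq_invariant (fun w => f (papp p w)).
Proof. by move=> Hf u w uw; apply/Hf/papp_weq. Qed.

Lemma weq_invariantB f g : weq_invariant f -> weq_invariant g ->
  weq_invariant (fun w => f w - g w).
Proof. by move=> Hf Hg u w uw; rewrite (Hf _ _ uw) (Hg _ _ uw). Qed.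

(** Swapping [a] and [c] costs two degrees, after which [linv c] and [c] cancel. *)
Lemma deg_lt_conj_letter k c a f : weq_invariant f -> deg_lt k.+2 f ->
  deg_lt k (fun w => f ([:: linv c; a; c] ++ w) - f (a :: w)).
Proof.
move=> If Hf.
have := deg_lt_swap [:: a] [:: c] (deg_lt_catl [:: linv c] Hf).
apply: deg_lt_ext => w /=; congr (_ - _); apply: If.
exact: (@weq_cat _ [:: linv c; c] [::] (a :: w) (a :: w) (weq_linv c)).
Qed.

Lemma wactE i j e m s : exists c : 'I_n * bool,
  wact (i, j, e) [:: (m, s)] =
    if m == i then [:: linv c; (m, s); c] else [:: (m, s)].
Proof.
exists (j, e); rewrite /wact /wsubst /xi_img /= cats0.
by case: eqP => [->|_]; case: s; case: e.
Qed.

Lemma deg_lt_wact_word k l u f : weq_invariant f -> deg_lt k.+2 f ->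
  deg_lt k (fun w => f (wact l u ++ w) - f (u ++ w)).
Proof.
elim: u f => [|[m s] u IHu] f If Hf.
  by apply: deg_lt_ext (deg_lt0 k) => w; rewrite subrr.
have H1 : deg_lt k (fun w => f (wact l [:: (m, s)] ++ w) - f ((m, s) :: w)).
  case: l {IHu} => [[i j] e]; have [c ->] := wactE i j e m s.
  case: eqP => _; first exact: deg_lt_conj_letter.
  by apply: deg_lt_ext (deg_lt0 k) => w; rewrite subrr.
have If' : weq_invariant (fun w => f ((m, s) :: w)).
  exact: (@weq_invariant_catl [:: _] f If).
have Hf' : deg_lt k.+2 (fun w => f ((m, s) :: w)).
  exact: (deg_lt_catl [:: _]).
have H2 := IHu _ If' Hf'.
apply: deg_lt_ext (deg_ltD (deg_lt_catl (wact l u) H1) H2) => w /=.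
by rewrite [wact l ((m, s) :: u)]wsubst_cons catA; ring.
Qed.

(** The difference along [u] splits in two: the difference of [f] along [wact l u], to which
    induction applies, and the replacement of [u] by [wact l u], bounded by [deg_lt_wact_word]. *)
Lemma deg_lt_wact k l f : weq_invariant f -> deg_lt k.+1 f ->
  deg_lt k (fun w => f (wact l w) - f w).
Proof.
elim: k f => [|k IHk] f If Hf.
  by move=> w; rewrite !(deg_lt1_const _ Hf) subrr.
move=> u; have IDf := weq_invariantB (@weq_invariant_catl (wact l u) _ If) If.
apply: deg_lt_ext (deg_ltD (IHk _ IDf (Hf _)) (deg_lt_wact_word l u If Hf)) => w /=.
by rewrite [wact l (u ++ w)]wsubst_cat; ring.
Qed.

(** * Lowering of degree along the lower central series *)

Definition lowers (d : nat) p : Prop := forall k f,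
  weq_invariant f -> deg_lt (k + d) f -> deg_lt k (fun w => f (papp p w) - f w).

Lemma lowers_nil d : lowers d [::].
Proof. by move=> k f _ _; apply: deg_lt_ext (deg_lt0 k) => w; rewrite subrr. Qed.

Lemma lowers_cat d p q : lowers d p -> lowers d q -> lowers d (p ++ q).
Proof.
move=> Hp Hq k f If Hf.
apply: deg_lt_ext (deg_ltD (deg_lt_papp q (Hp _ _ If Hf)) (Hq _ _ If Hf)) => w.
by rewrite papp_cat; ring.
Qed.

Lemma papp_pinvr p w : weq (papp p (papp (pinv p) w)) w.
Proof. by rewrite -papp_cat; have /peqP := peq_pinvr p; apply. Qed.

Lemma papp_pinvl p w : weq (papp (pinv p) (papp p w)) w.
Proof. by rewrite -papp_cat; have /peqP := peq_pinvl p; apply. Qed.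

Lemma lowers_pinv d p : lowers d p -> lowers d (pinv p).
Proof.
move=> Hp k f If Hf.
apply: deg_lt_ext (deg_ltZ (-1) (deg_lt_papp (pinv p) (Hp _ _ If Hf))) => w /=.
by rewrite (If _ _ (papp_pinvr p w)); ring.
Qed.

Lemma lowers_peq d p q : peq p q -> lowers d p -> lowers d q.
Proof.
move=> /peqP pq Hp k f If Hf; apply: deg_lt_ext (Hp _ _ If Hf) => w /=.
by rewrite (If _ _ (pq w)).
Qed.

Lemma lowers_gen_sub d (S : pword n -> Prop) :
  (forall p, S p -> lowers d p) -> forall p, gen_sub S p -> lowers d p.
Proof.
move=> HS p; elim=> [q /HS //||u v _ Hu _ Hv|u _ Hu|u v _ Hu uv].
- exact: lowers_nil.
- exact: lowers_cat.
- exact: lowers_pinv.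
- exact: lowers_peq uv Hu.
Qed.

(* The commutator acts, up to composition with an automorphism, through
   (a - 1)(b - 1) - (b - 1)(a - 1). *)
Lemma lowers_pcomm d e p q : lowers d p -> lowers e q ->
  lowers (d + e) (pcomm p q).
Proof.
(* [F] absorbs the factors p^-1 q^-1: the commutator turns [f] into F o p o q, while [f] itself is F
   o q o p. *)
move=> Hp Hq k f If Hf; pose F w := f (papp (pinv p ++ pinv q) w).
have IF : weq_invariant F by apply: weq_invariant_papp.
have HF : deg_lt (k + (d + e)) F by apply: deg_lt_papp.
have Hpq := Hp k _ (weq_invariantB (@weq_invariant_papp q _ IF) IF).
have Hqp := Hq k _ (weq_invariantB (@weq_invariant_papp p _ IF) IF).
have Hp' : deg_lt (k + e) (fun w => F (papp p w) - F w).
  by apply: Hp => //; rewrite -addnA (addnC e).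
have Hq' : deg_lt (k + d) (fun w => F (papp q w) - F w).
  by apply: Hq => //; rewrite -addnA.
apply: deg_lt_ext (deg_ltB (Hqp Hp') (Hpq Hq')) => w /=.
have -> : f w = F (papp q (papp p w)).
  rewrite /F papp_cat; apply: If; apply: esym.
  by apply: etrans (papp_pinvl p w); apply: papp_weq; apply: papp_pinvl.
have -> : f (papp (pcomm p q) w) = F (papp p (papp q w)).
  by rewrite /F /pcomm !papp_cat.
by ring.
Qed.

(** A generator lowers degree by one, and these amounts add up under commutators. *)
Lemma lowers_lcs k p : lcs k p -> lowers k.+1 p.
Proof.
have H0 q : PSigma q -> lowers 1 q.
  apply: lowers_gen_sub => _ [i [j [_ ->]]] k' f If Hf.
  by rewrite addn1 in Hf; apply: deg_lt_wact.
elim: k p => [|k IHk] p; first exact: H0.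
apply: lowers_gen_sub => _ [a [b [Ha [Hb ->]]]].
by rewrite -addn1; apply: lowers_pcomm; [apply: IHk | apply: H0].
Qed.

Lemma lcs2_fix f p w : weq_invariant f -> deg_lt 4 f -> lcs 2 p ->
  f (papp p w) = f w.
Proof.
move=> If Hf /lowers_lcs/(_ 1 f If Hf) Hp; apply: subr0_eq.
by rewrite (deg_lt1_const w Hp) papp_nil subrr.
Qed.

(** * Additivity of increments on automorphisms lowering degree by two *)

Section Increment.
Variables (f : fword n -> int) (w : fword n).
Hypotheses (If : weq_invariant f) (Hf : deg_lt 4 f).

Definition incr p : int := f (papp p w) - f w.

(** Precomposing with [p] changes [f] by a function of degree below 2, which [q], lowering degree by
    2, leaves unchanged. *)
Lemma incr_cat p q : lowers 2 p -> lowers 2 q ->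
  incr (p ++ q) = incr p + incr q.
Proof.
move=> Hp Hq.
have := Hq 0 _ (weq_invariantB (@weq_invariant_papp p _ If) If) (Hp 2 _ If Hf) w.
by rewrite /incr papp_cat => /subr0_eq <-; ring.
Qed.

Lemma incr_nil : incr [::] = 0. Proof. by rewrite /incr subrr. Qed.

Lemma incr_pinv p : lowers 2 p -> incr (pinv p) = - incr p.
Proof.
move=> Hp; apply/eqP; rewrite -subr_eq0 opprK -incr_cat //; last exact: lowers_pinv.
have /peqP H := peq_pinvl p.
by rewrite /incr (If (H w)) subrr.
Qed.

Lemma lowers_nseq d p k : lowers d p -> lowers d (flatten (nseq k p)).
Proof. by move=> Hp; elim: k => [|k IHk]; [apply: lowers_nil | apply: lowers_cat]. Qed.

Lemma incr_nseq p k : lowers 2 p -> incr (flatten (nseq k p)) = k%:Z * incr p.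
Proof.
move=> Hp; elim: k => [|k IHk]; first by rewrite incr_nil mul0r.
rewrite [LHS](incr_cat Hp) ?IHk; last exact: lowers_nseq.
by rewrite intS; ring.
Qed.

Lemma lowers_ppow d p z : lowers d p -> lowers d (ppow p z).
Proof. by move=> Hp; case: z => k; apply: lowers_nseq => //; apply: lowers_pinv. Qed.

Lemma incr_ppow p z : lowers 2 p -> incr (ppow p z) = z * incr p.
Proof.
move=> Hp; case: z => k; rewrite /ppow incr_nseq //; last exact: lowers_pinv.
by rewrite incr_pinv // NegzE mulrN mulNr.
Qed.

Lemma incr_pprod_pow (T : Type) (F : T -> pword n) (s : seq T) (es : seq int) :
  (forall x, lowers 2 (F x)) ->
  incr (pprod_pow [seq F x | x <- s] es) =
    \sum_(y <- zip s es) y.2 * incr (F y.1).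
Proof.
move=> HF; have L t es' : lowers 2 (pprod_pow [seq F x | x <- t] es').
  elim: t es' => [|x t IHt] [|e es'] /=; try exact: lowers_nil.
  exact: lowers_cat (lowers_ppow e (HF x)) (IHt es').
elim: s es => [|x s IHs] [|e es] /=; rewrite ?big_nil ?incr_nil // big_cons -IHs.
rewrite -incr_ppow //.
exact: incr_cat (lowers_ppow e (HF x)) (L s es).
Qed.

End Increment.

End PolynomialFunctions.

(** * Magnus coefficients *)

Section Magnus.
Variable n : nat.
Local Open Scope ring_scope.
Import GRing.Theory.
Implicit Types (w : fword n) (I : seq 'I_n) (i j t m : 'I_n).

(* Coefficient of X_I in the Magnus expansion x_m |-> 1 + X_m, with x_m^-1
   truncated to 1 - X_m; the truncation is harmless as long as consecutive
   entries of I are distinct. *)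
Fixpoint magnus w I : int :=
  if w is x :: w' then
    magnus w' I +
      (if I is a :: I' then
         if x.1 == a then (if x.2 then 1 else -1) * magnus w' I' else 0
       else 0)
  else (size I == 0)%:R.

Lemma magnus_nil w : magnus w [::] = 1.
Proof. by elim: w => //= x w ->; rewrite addr0. Qed.

(** Each letter prepended to a word adds a multiple of the coefficient for the tail of [I], of lower
    degree by induction. *)
Lemma deg_lt_magnus k I : (size I < k)%N -> deg_lt k (fun w => magnus w I).
Proof.
elim: k I => // k IHk I HI u.
elim: u => [|x u IHu]; first by apply: deg_lt_ext (@deg_lt0 n k) => w; rewrite subrr.
case: I HI IHu => [|a I] HI IHu.
  by apply: deg_lt_ext (@deg_lt0 n k) => w; rewrite !magnus_nil subrr.
have H := deg_ltZ (if x.1 == a then if x.2 then 1 else -1 else 0)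
  (deg_lt_catl u (IHk _ HI)).
apply: deg_lt_ext (deg_ltD IHu H) => w /=.
by case: ifP => _; ring.
Qed.

(** Cancelling pairs contribute (1 + X)(1 - X) = 1 - X^2, and the square is invisible when
    neighbours in [I] differ. *)
Lemma magnus_cons_red x w I : sorted (fun a b => a != b) I ->
  magnus (cons_red x w) I = magnus (x :: w) I.
Proof.
case: w => // y w HI; rewrite cons_redE; case: eqP => // -> /=.
case: I HI => [|a I] HI; first by ring.
case: eqP => [xa|_]; last by ring.
have -> : (if I is b :: I' then
   if x.1 == b then (if ~~ x.2 then 1 else -1) * magnus w I' else 0 else 0) = 0.
  by case: I HI => //= b I /andP[ab _]; rewrite xa (negPf ab).
by case: x.2 => /=; ring.
Qed.

Lemma magnus_freduce w I : sorted (fun a b => a != b) I ->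
  magnus (freduce w) I = magnus w I.
Proof.
elim: w I => // x w IHw I HI.
rewrite [freduce _]/= magnus_cons_red //= (IHw I) //.
case: I HI => // a I HI; rewrite (IHw I) //.
by case: I HI => //= b I /andP[].
Qed.

Lemma magnus_weq_invariant I : sorted (fun a b => a != b) I ->
  weq_invariant (fun w => magnus w I).
Proof. by move=> HI u v uv; rewrite -magnus_freduce // uv magnus_freduce. Qed.

Lemma magnus_absent w I a : a \in I -> all (fun x => x.1 != a) w ->
  magnus w I = 0.
Proof.
elim: w I => [|x w IHw] I aI /=; first by case: I aI.
move=> /andP[xa Hw]; rewrite IHw // add0r.
case: I aI => // b I; rewrite inE; have [<-|ab aI] := eqVneq a b.
  by rewrite (negPf xa).
by rewrite IHw // mulr0 if_same.
Qed.

(** The image of x_i is its conjugate by the commutator (x_j, x_t). *)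
Lemma peval_ijit i j t m : j != i -> t != i -> j != t ->
  peval (pcomm (xi i j) (xi i t)) m =
    if m == i then [:: (t, false); (j, false); (t, true); (j, true); (i, true);
                       (j, false); (t, false); (j, true); (t, true)]
    else [:: (m, true)].
Proof.
move=> /neq_false ji /neq_false ti /neq_false jt.
rewrite /peval /= /xi_act /fsubst /xi_img /=.
have [mi|/neq_false mi] := eqVneq m i; last by do !rewrite /= ?mi.
by do !rewrite /= ?(eqxx, mi, ji, ti, jt).
Qed.

(** x_i is conjugated by x_j x_i^-1 x_j^-1, and x_j by x_i x_j x_i^-1 x_j^-1. *)
Lemma peval_ijji i j m : j != i ->
  peval (pcomm (xi i j) (xi j i)) m =
    if m == i then [:: (j, true); (i, true); (j, false); (i, true); (j, true);
                       (i, false); (j, false)]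
    else if m == j then [:: (j, true); (i, true); (j, false); (i, false); (j, true);
                            (i, true); (j, true); (i, false); (j, false)]
    else [:: (m, true)].
Proof.
move=> /neq_false ji.
rewrite /peval /= /xi_act /fsubst /xi_img /=.
have [mi|/neq_false mi] := eqVneq m i.
by do !rewrite /= ?(eqxx, mi, ji).
have [mj|/neq_false mj] := eqVneq m j.
  by do !rewrite /= ?(eqxx, mj, ji).
by do !rewrite /= ?(mi, mj).
Qed.

(* The triple (i, j, i) encodes the pair {i, j}. *)
Definition bcomm (x : 'I_n * 'I_n * 'I_n) : pword n :=
  let: (i, j, t) := x in
  if t == i then pcomm (xi i j) (xi j i) else pcomm (xi i j) (xi i t).

Definition bindex (x : 'I_n * 'I_n * 'I_n) : bool :=
  let: (i, j, t) := x in
  (j != i) && (if t == i then i < j else j < t)%N.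

Definition bcoef (x : 'I_n * 'I_n * 'I_n) (p : pword n) : int :=
  let: (i, j, t) := x in
  incr (fun w => magnus w [:: i; j; t]) [:: (i, true)] p.

Lemma bindex_sorted i j t :
  bindex (i, j, t) -> sorted (fun a b => a != b) [:: i; j; t].
Proof.
move=> /andP[ji Ht]; rewrite /= andbT (eq_sym i) ji /=.
by case: eqP Ht => [-> //|_ jt]; rewrite neq_ltn jt.
Qed.

Lemma bcoefE i j t p : bindex (i, j, t) ->
  bcoef (i, j, t) p = magnus (peval p i) [:: i; j; t].
Proof.
move=> /bindex_sorted Hs; rewrite /bcoef /incr pevalE magnus_freduce //.
have -> : magnus [:: (i, true)] [:: i; j; t] = 0 by rewrite /= eqxx.
by rewrite subr0.
Qed.

(** Counting signed subwords gives -2 when [t = i] and 1 otherwise; a nonzero value suffices for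
    independence. *)
Lemma bcoef_diag x : bindex x -> bcoef x (bcomm x) != 0.
Proof.
case: x => [[i j] t] Hx; rewrite bcoefE //; case/andP: Hx => ji.
rewrite /bcomm; have [->|ti] := eqVneq t i => Hlt.
  rewrite peval_ijji // eqxx; move/neq_false: ji => ji.
  by do !rewrite /= ?(eqxx, ji).
have jt : j != t by rewrite neq_ltn Hlt.
rewrite peval_ijit // eqxx.
move/neq_false: ji => ji; move/neq_false: ti => ti; move/neq_false: jt => jt.
by do !rewrite /= ?(eqxx, ji, ti, jt).
Qed.

Lemma magnus_letter i j t m : j != m -> magnus [:: (m, true)] [:: i; j; t] = 0.
Proof.
by move=> jm; apply: (@magnus_absent _ _ j); rewrite ?inE ?eqxx ?orbT //= eq_sym jm.
Qed.

(** Either [y] fixes x_i, or the image of x_i lacks x_j or x_t, or [t = i] and x_i occurs only once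
    in its image. *)
Lemma bcoef_off x y : bindex x -> bindex y -> x != y -> bcoef x (bcomm y) = 0.
Proof.
case: x y => [[i j] t] [[i' j'] t'] Hx Hy; rewrite bcoefE //.
case/andP: Hx Hy => ji Hx /andP[ji' Hy].
have absent a w : a \in [:: j; t] -> all (fun x => x.1 != a) w ->
    magnus w [:: i; j; t] = 0.
  by move=> aI; apply: magnus_absent; rewrite inE aI orbT.
rewrite /bcomm; case: (eqVneq t' i') Hy => [->|ti'] Hy xy.
  rewrite peval_ijji //; have [ii|ii] := eqVneq i i'.
    have [jj|jj] := eqVneq j j'.
      have ti : t != i by apply: contraNneq xy => ->; rewrite ii jj.
      have tj : t != j by move: Hx; rewrite (negPf ti) neq_ltn orbC => ->.
      apply: (@absent t); first by rewrite !inE eqxx orbT.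
      by rewrite /= -jj -ii (neq_false ti) (neq_false tj).
    apply: (@absent j); first by rewrite !inE eqxx.
    by rewrite /= -ii (neq_false ji) (neq_false jj).
  have [ij|ij] := eqVneq i j'; last first.
    exact: magnus_letter.
  have [ji'E|ji'E] := eqVneq j i'.
    have ti : t != i.
      (* Otherwise both triples would encode the same pair, with opposite orders. *)
      by apply/eqP => ti; move: Hx Hy; rewrite ti eqxx -ij -ji'E; lia.
    have tj : t != j by move: Hx; rewrite (negPf ti) neq_ltn orbC => ->.
    apply: (@absent t); first by rewrite !inE eqxx orbT.
    by rewrite /= -ij -ji'E (neq_false ti) (neq_false tj).
  apply: (@absent j); first by rewrite !inE eqxx.
  by rewrite /= -ij (neq_false ji) (neq_false ji'E).
have jt' : j' != t' by rewrite neq_ltn Hy.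
rewrite peval_ijit //; have [ii|ii] := eqVneq i i'; last exact: magnus_letter.
rewrite -ii in ji' ti' xy *.
have [jj|jj] := boolP (j \in [:: j'; t']); last first.
  apply: (@absent j); first by rewrite !inE eqxx.
  move: jj; rewrite !inE negb_or => /andP[jj jt].
  by rewrite /= (neq_false ji) (neq_false jj) (neq_false jt).
have [ti|ti] := eqVneq t i.
  (* The monomial X_i X_j X_i needs two occurrences of x_i, but the word has one. *)
  rewrite ti; move: jj; rewrite !inE => jj.
  move/neq_false: ji => ji; move/neq_false: ji' => ji'.
  move/neq_false: ti' => ti'; move/neq_false: jt' => jt'.
  by case/orP: jj => /eqP jj; do !rewrite /= ?(eqxx, jj, ji, ji', ti', jt').
have jlt : (j < t)%N by rewrite (negPf ti) in Hx.
apply: (@absent t); first by rewrite !inE eqxx orbT.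
(* If [j] and [t] both lay in {j', t'}, the orders j < t and j' < t' would force [x = y]. *)
suff /andP[tj tt] : (t != j') && (t != t').
  by rewrite /= (neq_false ti) (neq_false tj) (neq_false tt).
move: jj; rewrite !inE => jj; apply/andP; split; apply/eqP => tE.
  by case/orP: jj => /eqP jE; move: Hy jlt; rewrite tE jE; lia.
case/orP: jj => /eqP jE; last by move: jlt; rewrite tE jE ltnn.
by move: xy; rewrite tE jE eqxx.
Qed.

End Magnus.

(** * The basis *)

Lemma uniq_flatten_tagged (S T : eqType) (s : seq S) (F : S -> seq T) (g : T -> S) :
  uniq s -> (forall i, uniq (F i)) -> (forall i x, x \in F i -> g x = i) ->
  uniq (flatten [seq F i | i <- s]).
Proof.
move=> + HF Hg; elim: s => //= i s IHs /andP[si Hs].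
rewrite cat_uniq HF IHs // andbT /=; apply/hasPn => x /flattenP[_ /mapP[j js ->]].
move=> /Hg gx; apply: contra si => /Hg; rewrite gx => <-; exact: js.
Qed.

Lemma size_flatten_map (S T : Type) (s : seq S) (F : S -> seq T) :
  size (flatten [seq F i | i <- s]) = \sum_(i <- s) size (F i).
Proof. by elim: s => [|i s IHs] /=; rewrite ?big_nil // big_cons size_cat IHs. Qed.

(** The system is diagonal with nonzero diagonal entries, so each equation isolates one exponent. *)
Lemma zip_diag_eq0 (T : eqType) (D : T -> T -> int) (s : seq T) (es : seq int) :
  uniq s -> size es = size s ->
  {in s, forall x, D x x != 0%R} ->
  {in s &, forall x y, x != y -> D x y = 0%R} ->
  {in s, forall x, (\sum_(y <- zip s es) y.2 * D x y.1)%R = 0%R} ->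
  all (fun e => e == 0%R) es.
Proof.
elim: s es => [|x s IHs] [|e es] //= /andP[xs Us] [Hes] D1 D0 HD.
have e0 : e = 0%R.
  have := HD x (mem_head _ _); rewrite big_cons /=.
  rewrite big1_seq ?GRing.addr0 => [/eqP|[y c] /andP[_ yc] /=].
    by rewrite GRing.mulf_eq0 (negPf (D1 _ (mem_head _ _))) orbF => /eqP.
  have ys : y \in s.
    have -> : s = unzip1 (zip s es) by rewrite unzip1_zip ?Hes.
    exact: (map_f fst yc).
  rewrite D0 ?GRing.mulr0 ?mem_head ?inE ?ys ?orbT //.
  by apply: contraNneq xs => ->.
rewrite e0 eqxx; apply: IHs => // [y ys|y z ys zs|y ys].
- by apply: D1; rewrite inE ys orbT.
- by apply: D0; rewrite inE (ys, zs) orbT.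
- have := HD y; rewrite big_cons e0 GRing.mul0r GRing.add0r; apply.
  by rewrite inE ys orbT.
Qed.

Section Basis.
Variable n : nat.

(** Triples listed in the order of the basis words, so that distinctness and counting concern
    indices rather than words. *)
Definition bidx1 : seq ('I_n * 'I_n * 'I_n) :=
  flatten [seq [seq (i, j, i) | j : 'I_n <- enum 'I_n & (i < j)%N]
          | i : 'I_n <- enum 'I_n].

Definition bidx2 : seq ('I_n * 'I_n * 'I_n) :=
  flatten [seq flatten [seq [seq (i, j, t)
                              | t : 'I_n <- enum 'I_n & ((j < t)%N && (t != i))]
                       | j : 'I_n <- enum 'I_n & j != i]
          | i : 'I_n <- enum 'I_n].

Definition bidx := bidx1 ++ bidx2.

Lemma psigma_basisE : psigma_basis n = [seq @bcomm n x | x <- bidx].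
Proof.
rewrite /bidx map_cat; congr (_ ++ _).
  rewrite map_flatten -map_comp; congr flatten; apply: eq_map => i /=.
  by rewrite -map_comp; apply: eq_map => j /=; rewrite eqxx.
rewrite map_flatten -map_comp; congr flatten; apply: eq_map => i /=.
rewrite map_flatten -map_comp; congr flatten; apply: eq_map => j /=.
rewrite -map_comp; apply/eq_in_map => t; rewrite mem_filter.
by move=> /andP[/andP[_ ti] _]; rewrite /= (negPf ti).
Qed.

Lemma mem_bidx x : (x \in bidx) = bindex x.
Proof.
case: x => [[i j] t]; rewrite mem_cat; apply/idP/idP.
  case/orP => /flattenP[_ /mapP[i' _ ->]].
    case/mapP => j'; rewrite mem_filter => /andP[ij _] [-> -> ->] /=.
    by rewrite eqxx ij andbT neq_ltn ij orbT.
  case/flattenP => s /mapP[j']; rewrite mem_filter => /andP[ji _] ->.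
  case/mapP => t'; rewrite mem_filter => /andP[/andP[jt ti] _] [-> -> ->] /=.
  by rewrite ji (negPf ti).
case/andP => ji; case: eqVneq => [->|ti] Hlt; apply/orP; [left|right].
  apply/flattenP; exists [seq (i, j, i) | j : 'I_n <- enum 'I_n & (i < j)%N].
    by apply: map_f; rewrite mem_enum.
  by apply/mapP; exists j => //; rewrite mem_filter Hlt mem_enum.
apply/flattenP; exists (flatten [seq [seq (i, j, t)
    | t : 'I_n <- enum 'I_n & ((j < t)%N && (t != i))]
    | j : 'I_n <- enum 'I_n & j != i]).
  apply/mapP; exists i => //; exact: mem_enum.
apply/flattenP; exists [seq (i, j, t) | t : 'I_n <- enum 'I_n & ((j < t)%N && (t != i))].
  by apply/mapP; exists j => //; rewrite mem_filter ji mem_enum.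
by apply/mapP; exists t => //; rewrite mem_filter Hlt ti mem_enum.
Qed.

Lemma bidx_uniq : uniq bidx.
Proof.
rewrite cat_uniq; apply/and3P; split.
- apply: (uniq_flatten_tagged (g := fun x => x.1.1)) (enum_uniq _) _ _ => [i|i x].
  + by rewrite map_inj_uniq; [apply/filter_uniq/enum_uniq | move=> j k []].
  + by case/mapP => j _ ->.
- apply/hasPn => -[[i j] t] /flattenP[_ /mapP[i' _ ->]] /flattenP[_ /mapP[j' _ ->]].
  case/mapP => t'; rewrite mem_filter => /andP[/andP[_ ti] _] [-> _ ->].
  apply/negP => /flattenP[_ /mapP[k _ ->]] /mapP[l _ [ik _ tk]].
  by rewrite ik tk eqxx in ti.
- apply: (uniq_flatten_tagged (g := fun x => x.1.1)) (enum_uniq _) _ _ => [i|i x].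
  + apply: (uniq_flatten_tagged (g := fun x => x.1.2)) (filter_uniq _ (enum_uniq _)) _ _ => [j|j x].
    * by rewrite map_inj_uniq; [apply/filter_uniq/enum_uniq | move=> t u []].
    * by case/mapP => t _ ->.
  + by case/flattenP => _ /mapP[j _ ->] /mapP[t _ ->].
Qed.

(** Increasing and decreasing pairs are equally many and together exhaust the ordered pairs of
    distinct elements. *)
Lemma count_increasing_pairs (P : pred 'I_n) :
  (\sum_(j | P j) \sum_(t | P t) (j < t) = (#|P| * #|P|.-1)./2)%N.
Proof.
pose S := (\sum_(j | P j) \sum_(t | P t) (j < t))%N.
have ES : S = (\sum_(j | P j) \sum_(t | P t) (t < j))%N by rewrite exchange_big.
have DS : S.*2 = (#|P| * #|P|.-1)%N.
  rewrite -addnn {2}ES -big_split -sum_nat_const; apply: eq_bigr => j Pj /=.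
  rewrite -big_split /= (bigD1 j) //= ltnn add0n (cardD1 j) [j \in _]Pj -sum1_card.
  apply: eq_big => [t|t /andP[_ tj]]; first by rewrite !inE andbC.
  by move: tj; rewrite neq_ltn; case: (ltngtP t j).
by rewrite -DS doubleK.
Qed.

Lemma size_basis : size (psigma_basis n) = ((n - 1) * rn2 n)%N.
Proof.
(* Parity makes the halves exact, so the count becomes a polynomial identity. *)
have even k : ~~ odd (k * k.-1) by case: k => //= k; rewrite oddM /= andNb.
rewrite psigma_basisE size_map size_cat.
have -> : size bidx1 = (n * n.-1)./2.
  have := count_increasing_pairs xpredT; rewrite card_ord => <-.
  rewrite size_flatten_map big_enum /=; apply: eq_bigr => i _.
  rewrite size_map size_filter -sum1_count big_enum_cond /= big_mkcond.
  by apply: eq_bigr => j _; case: ltnP.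
have -> : size bidx2 = (n * (n.-1 * n.-2)./2)%N.
  have <- : (\sum_(i < n) (n.-1 * n.-2)./2 = n * (n.-1 * n.-2)./2)%N.
    by rewrite sum_nat_const card_ord.
  rewrite size_flatten_map big_enum /=; apply: eq_bigr => i _.
  rewrite size_flatten_map big_filter big_enum_cond /=.
  have := count_increasing_pairs (fun t => t != i).
  rewrite (_ : #|_| = n.-1); last by rewrite cardC1 card_ord.
  move=> <-; apply: eq_bigr => j _.
  rewrite size_map size_filter -sum1_count big_enum_cond /= [RHS]big_mkcond [LHS]big_mkcond.
  by apply: eq_bigr => t _; case: ltnP; case: eqP.
have -> : rn2 n = (n * n.-1)./2.
  by rewrite /rn2 divn2; congr (_./2); case: (n) => // k; rewrite -mulnn mulnS addKn.
have := even n; have := even n.-1.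
move: ((n.-1 * n.-2)./2) ((n * n.-1)./2)
  (odd_double_half (n.-1 * n.-2)) (odd_double_half (n * n.-1)).
move=> a b + + /negPf He /negPf Ho; rewrite He Ho !add0n -!muln2 => Ea Eb.
case: n Ea Eb {He Ho even} => [|k]; first by lia.
rewrite subn1 /= => Ea Eb; case: k Ea Eb => [|k] /=; nia.
Qed.

Lemma rank_formula : ((n - 1) * rn2 n = (n * (n - 1) ^ 2) %/ 2)%N.
Proof.
have E : (rn2 n * 2 = n * (n - 1))%N.
  rewrite /rn2 divnK; last first.
    by rewrite dvdn2; case: (n) => // k; rewrite -mulnn mulnS addKn oddM /= andNb.
  by case: (n) => // k; rewrite -mulnn mulnS addKn subn1 mulnC.
by rewrite expnS expn1 mulnA -E -mulnA (mulnC 2) mulnA mulnK // mulnC.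
Qed.

Lemma bcomm_lcs1 x : bindex x -> lcs 1 (@bcomm n x).
Proof.
have PS (i j : 'I_n) : i != j -> PSigma (xi i j) by move=> ij; apply: gs_gen; exists i, j.
case: x => [[i j] t] /andP[ji _]; rewrite eq_sym in ji; rewrite /bcomm.
case: eqVneq => [_|ti]; apply: gs_gen; exists (xi i j).
  by exists (xi j i); split; [exact: PS | split=> //; apply: PS; rewrite eq_sym].
by exists (xi i t); split; [exact: PS | split=> //; apply: PS; rewrite eq_sym].
Qed.

Lemma basis_spans (w : pword n) : lcs 1 w ->
  exists es : seq int, size es = size (psigma_basis n) /\
    lcs 2 (w ++ pinv (pprod_pow (psigma_basis n) es)).
Proof.
pose B := [seq pclass b | b <- psigma_basis n].
have B_mem x : bindex x -> pclass (bcomm x) \in B.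
  by move=> Hx; rewrite /B psigma_basisE -map_comp; apply: map_f; rewrite mem_bidx.
have B_lcs b : b \in B -> glcs (@xiset n) 1 b.
  rewrite /B psigma_basisE -map_comp => /mapP[x]; rewrite mem_bidx => Hx ->.
  by apply/lcsE/bcomm_lcs1.
move=> /lcsE Hw.
have [||es [Hes Ees]] := glcs1_xi_spanned B_lcs _ _ Hw.
- move=> i j ij; have := @B_mem (i, j, i).
  by rewrite /= eqxx pclassR; apply; rewrite ij neq_ltn ij orbT.
- move=> i j t ji ti jt; have := @B_mem (i, j, t).
  by rewrite /= (negPf ti) ji pclassR; apply.
exists es; split; first by rewrite Hes size_map.
apply/lcsE; rewrite pclassM pclassV pclass_pprod_pow -/B.
exact: eqm_div (glcs_sgen Hw) Ees.
Qed.

Lemma bcoef_pprod_pow x es : bindex x ->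
  bcoef x (pprod_pow (psigma_basis n) es) =
    (\sum_(y <- zip bidx es) y.2 * bcoef x (bcomm y.1))%R.
Proof.
move=> Hx; have L1 i j : lowers 1 (@xi n i j).
  by move=> k f If; rewrite addn1; apply: deg_lt_wact.
rewrite psigma_basisE; case: x Hx => [[i j] t] Hx; apply: incr_pprod_pow.
- exact/magnus_weq_invariant/bindex_sorted.
- exact: deg_lt_magnus.
- move=> [[a b] c]; rewrite /bcomm.
  by case: ifP => _; apply: (@lowers_pcomm _ 1 1).
Qed.

(** Every [bcoef] vanishes on Gamma_3, and the matrix of these functions on the basis is
    diagonal. *)
Lemma basis_independent (es : seq int) : size es = size (psigma_basis n) ->
  lcs 2 (pprod_pow (psigma_basis n) es) -> all (fun e => e == 0%R) es.
Proof.
move=> Hes H; rewrite psigma_basisE size_map in Hes.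
apply: (zip_diag_eq0 (D := fun x y => bcoef x (bcomm y))) bidx_uniq Hes _ _ _.
- by move=> x; rewrite mem_bidx => /bcoef_diag.
- by move=> x y; rewrite !mem_bidx => Hx Hy; apply: bcoef_off.
move=> x; rewrite mem_bidx => Hx; rewrite -bcoef_pprod_pow //.
case: x Hx => [[i j] t] /bindex_sorted/magnus_weq_invariant Im.
have I4 : deg_lt 4 (fun w => magnus w [:: i; j; t]) by apply: deg_lt_magnus.
by rewrite /bcoef /incr (lcs2_fix [:: (i, true)] Im I4 H) GRing.subrr.
Qed.

End Basis.

Theorem theorem3p1p2 (n : nat) (hn : 4 <= n) :
  (* rank: number of basis elements *)
  size (psigma_basis n) = (n - 1) * rn2 n /\
  (n - 1) * rn2 n = (n * (n - 1) ^ 2) %/ 2 /\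
  (* the basis elements lie in Gamma_2 *)
  (forall b, b \in psigma_basis n -> @Gamma n 2 b) /\
  (* they generate Gamma_2 / Gamma_3 *)
  (forall w : pword n, @Gamma n 2 w ->
     exists es : seq int, size es = size (psigma_basis n) /\
       @Gamma n 3 (w ++ pinv (pprod_pow (psigma_basis n) es))) /\
  (* they are Z-linearly independent modulo Gamma_3 *)
  (forall es : seq int, size es = size (psigma_basis n) ->
     @Gamma n 3 (pprod_pow (psigma_basis n) es) -> all (fun e => e == 0%R) es).
Proof.
split; first exact: size_basis.
split; first exact: rank_formula.
split.
  by move=> b; rewrite psigma_basisE => /mapP[x]; rewrite mem_bidx => /bcomm_lcs1 Hx ->.
split; [exact: basis_spans | exact: basis_independent].
Qed.
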